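(* Let $R\subseteq S$ be an integral extension of rings. If $S$ is unit-additive, then so is $R$.
   Context: All rings are commutative and unital. A ring $R$ is unit-additive if whenever $u,v$ are units of $R$, $u+v$ is either a unit of $R$ or a nilpotent element. *)

(* Defs.v *)
From HB Require Import structures.
From mathcomp Require Import all_boot all_order all_algebra.
Set Implicit Arguments.
Unset Strict Implicit.
Unset Printing Implicit Defensive.
Import GRing.Theory.
Local Open Scope ring_scope.

(* Arbitrary commutative unital rings, the zero ring included, are
   [comPzRingType]s. The library's [GRing.unit], [integralOver] and [{poly R}]
   require stronger structures (boolean units, resp. 1 != 0), so the notions are
   spelled out here; [is_unitE] and [is_integral_overE] relate them to the
   library's versions where those are available. *)

Definition is_unit (R : comPzRingType) (x : R) : Prop :=
  exists y : R, x * y = 1.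

Definition is_nilpotent (R : comPzRingType) (x : R) : Prop :=
  exists n : nat, x ^+ n = 0.

Definition unit_additive (R : comPzRingType) : Prop :=
  forall u v : R, is_unit u -> is_unit v ->
    is_unit (u + v) \/ is_nilpotent (u + v).

(* [z] satisfies an equation z^n + c_(n-1) z^(n-1) + ... + c_0 = 0, the
   coefficients being images of elements of [R]. *)
Definition is_integral_over (R S : comPzRingType) (f : {rmorphism R -> S})
    (z : S) : Prop :=
  exists (n : nat) (c : 'I_n -> R), z ^+ n + \sum_(i < n) f (c i) * z ^+ i = 0.

(* [S] is an integral extension of [R], the inclusion being [f]. *)
Definition integral_extension (R S : comPzRingType) (f : {rmorphism R -> S}) :
    Prop :=
  injective f /\ forall z : S, is_integral_over f z.

Lemma is_unitE (R : comUnitRingType) (x : R) :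
  is_unit x <-> x \is a GRing.unit.
Proof.
split=> [[y xy] | Ux]; last by exists x^-1; rewrite divrr.
by apply/unitrP; exists y; rewrite mulrC.
Qed.

Lemma is_integral_overE (R S : comNzRingType) (f : {rmorphism R -> S})
    (z : S) :
  is_integral_over f z <-> integralOver f z.
Proof.
split=> [[n [c eqz]] | [p mon_p /eqP]].
  pose q : {poly R} := \sum_(i < n) (c i)%:P * 'X^i.
  have szq : (size q <= n)%N.
    apply: (leq_trans (size_sum _ _ _)); apply/bigmax_leqP => i _.
    rewrite mul_polyC; apply: leq_trans (size_scale_leq _ _) _.
    by rewrite size_polyXn ltn_ord.
  exists ('X^n + q).
    by rewrite monicE lead_coefDl ?lead_coefXn // size_polyXn ltnS.
  rewrite /root rmorphD /= map_polyXn hornerD hornerXn.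
  rewrite rmorph_sum horner_sum -[X in _ == X]eqz; apply/eqP; congr (_ + _).
  apply: eq_bigr => i _.
  by rewrite /= rmorphM /= map_polyC map_polyXn /= hornerCM hornerXn.
have lead1 : p`_(size p).-1 = 1 by apply/eqP; rewrite -monicE.
have szp : size p = (size p).-1.+1.
  by rewrite prednK // lt0n size_poly_eq0 monic_neq0.
rewrite (@horner_coef_wide _ (size p)) ?size_poly // szp big_ord_recr /=.
rewrite coef_map lead1 /= rmorph1 mul1r addrC => eqz.
exists (size p).-1, (fun i => p`_i); rewrite -[RHS]eqz; congr (_ + _).
by apply: eq_bigr => i _; rewrite coef_map.
Qed.

(* Main.v *)
Require Import Defs.
From mathcomp Require Import all_boot all_order all_algebra.
Import GRing.Theory.
Local Open Scope ring_scope.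

(** Units and nilpotents both descend along an injective integral ring map [f].
For units: if [f a * z = 1] and [z^n + sum_i f (c_i) z^i = 0], multiplying the
equation by [(f a)^n] yields [1 + sum_i f (c_i a^(n-i)) = 0], and [a] divides
every term of the sum since [i < n]. *)

Lemma is_unit_descent (R S : comPzRingType) (f : {rmorphism R -> S}) (a : R) :
  integral_extension f -> is_unit (f a) -> is_unit a.
Proof.
case=> f_inj f_int [z az1]; have [n [c eqz]] := f_int z.
(* One factor [a] is taken out of each [a ^+ (n - i)]; as [i < n], the subtraction does not
   truncate. *)
exists (- \sum_(i < n) c i * a ^+ (n - i.+1)).
apply/f_inj/eqP; rewrite mulrN rmorphN rmorph1 -subr_eq0 -opprD oppr_eq0 addrC.
apply/eqP; rewrite -[RHS](mulr0 (f a ^+ n)) -[in RHS]eqz mulrDr -exprMn az1.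
rewrite expr1n; congr (_ + _); rewrite mulr_sumr mulr_sumr rmorph_sum.
apply: eq_bigr => i _; rewrite !rmorphM rmorphXn mulrCA -exprS.
rewrite subnSK // [RHS]mulrCA; congr (_ * _).
(* Splitting [n] as [(n - i) + i] lets [f a ^+ i] cancel [z ^+ i]. *)
rewrite -[X in _ = f a ^+ X * _](subnK (ltnW (ltn_ord i))).
by rewrite exprD -mulrA -exprMn az1 expr1n mulr1.
Qed.

Lemma is_nilpotent_descent (R S : comPzRingType) (f : {rmorphism R -> S})
    (a : R) :
  injective f -> is_nilpotent (f a) -> is_nilpotent a.
Proof.
by move=> f_inj [n an0]; exists n; apply: f_inj; rewrite rmorphXn an0 rmorph0.
Qed.

Lemma is_unit_rmorph (R S : comPzRingType) (f : {rmorphism R -> S}) (a : R) :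
  is_unit a -> is_unit (f a).
Proof. by case=> b ab1; exists (f b); rewrite -rmorphM ab1 rmorph1. Qed.

Theorem proposition2p8 (R S : comPzRingType) (f : {rmorphism R -> S})
    (hf : integral_extension f) (hS : unit_additive S) :
  unit_additive R.
Proof.
move=> u v Uu Uv.
have := hS _ _ (is_unit_rmorph R S f u Uu) (is_unit_rmorph R S f v Uv).
(* The sum of the two image units is [f (u + v)], so either alternative in [S] descends to
   [u + v]. *)
rewrite -rmorphD => -[Uuv | Nuv].
  by left; apply: is_unit_descent hf Uuv.
by right; apply: is_nilpotent_descent (proj1 hf) Nuv.
Qed.
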